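(* Let $q$ be any odd prime power and $\alpha$ any nonzero element of $\mathbb{F}_q$. For $n\ge1$ let $Q(X)=\sum_{i=0}^{n-1}(-1)^i x_i^2+(-1)^n\alpha x_n^2$ on $\mathbb{F}_q^{n+1}$ with associated bilinear form $\langle X,Y\rangle=\sum_{i=0}^{n-1}(-1)^i x_i y_i+(-1)^n\alpha x_n y_n$, and let $\mathbf{A}_{11},\mathbf{A}_{12},\mathbf{A}_{21},\mathbf{A}_{22}$ be the submatrices of the incidence matrix of $PG(n,q)$ defined in the context. Then: (1) in $PG(1,q)$, $\mathbf{A}_{11}$ and $\mathbf{A}_{22}$ both have full $2$-rank; (2) in $PG(2,q)$, the $2$-rank of $\mathbf{A}_{11}$ is $q^{2}-1$, the $2$-ranks of $\mathbf{A}_{12}$ and $\mathbf{A}_{21}$ are both $q$, and $\mathbf{A}_{22}$ has full $2$-rank.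
   Context: Points of $PG(n,q)$ are $1$-dimensional subspaces of $\mathbb{F}_q^{n+1}$; a point $P$ is isotropic if $Q(P)=0$ and anisotropic otherwise. For a point $P$, $P^{\perp}=\{R:\langle P,R\rangle=0\}$ is the corresponding hyperplane. The incidence matrix $\mathbf{A}$ has rows indexed by hyperplanes $P^\perp$ and columns by points $R$, with entry $1$ iff $R\in P^{\perp}$ (i.e. $\langle P,R\rangle=0$), and $0$ otherwise. It is partitioned into blocks: $\mathbf{A}_{11}$ has rows $P^\perp$ with $P$ anisotropic and columns the anisotropic points; $\mathbf{A}_{12}$ has rows $P^\perp$ with $P$ anisotropic and columns the isotropic points; $\mathbf{A}_{21}$ has rows $P^\perp$ with $P$ isotropic and columns the anisotropic points; $\mathbf{A}_{22}$ has rows $P^\perp$ with $P$ isotropic and columns the isotropic points. The $2$-rank of a $0/1$ matrix is its rank over $\mathbb{F}_2$; a square matrix has full rank if its rank equals its order. *)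

(* Defs.v *)
From HB Require Import structures.
From mathcomp Require Import all_boot all_order all_algebra.
Set Implicit Arguments.
Unset Strict Implicit.
Unset Printing Implicit Defensive.
Import GRing.Theory.
Local Open Scope ring_scope.

Section VspaceFinite.

(* For the subType structure of {vspace vT} over 'M[F]. *)
Import VectorInternalTheory.

Variables (F : finFieldType) (vT : vectType F).

HB.instance Definition _ := [Countable of {vspace vT} by <:].
HB.instance Definition _ := [Finite of {vspace vT} by <:].

End VspaceFinite.

Record pg_point (F : finFieldType) (n : nat) :=
  PgPoint { pg_space :> {vspace 'rV[F]_n.+1}; _ : (\dim pg_space == 1)%N }.

HB.instance Definition _ (F : finFieldType) (n : nat) :=
  [isSub for @pg_space F n].
HB.instance Definition _ (F : finFieldType) (n : nat) :=
  [Finite of pg_point F n by <:].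

Section Incidence.

Variables (F : finFieldType) (n : nat) (alpha : F).
Implicit Types (x y : 'rV[F]_n.+1) (P R : pg_point F n) (S T : {set pg_point F n}).

(* The first sum runs over the coordinates 0, ..., n-1; ord_max is the
   coordinate n. *)
Definition qform x : F :=
  \sum_(i < n) (-1) ^+ i * x 0 (widen_ord (leqnSn n) i) ^+ 2
  + (-1) ^+ n * alpha * x 0 ord_max ^+ 2.

Definition bform x y : F :=
  \sum_(i < n) (-1) ^+ i * x 0 (widen_ord (leqnSn n) i)
                         * y 0 (widen_ord (leqnSn n) i)
  + (-1) ^+ n * alpha * x 0 ord_max * y 0 ord_max.

Definition isotropic_points : {set pg_point F n} :=
  [set P : pg_point F n | [forall x, (x \in P) ==> (qform x == 0)]].

Definition anisotropic_points : {set pg_point F n} := ~: isotropic_points.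

Definition perp P : {set pg_point F n} :=
  [set R : pg_point F n | [forall x, forall y,
              (x \in P) && (y \in R) ==> (bform x y == 0)]].

(* Row i is the hyperplane perp (enum_val i), column j the point enum_val j.
   The entries live in 'F_2, so that \rank is the 2-rank. *)
Definition incidence_mx : 'M['F_2]_#|{: pg_point F n}| :=
  \matrix_(i, j) (enum_val j \in perp (enum_val i))%:R.

Definition incidence_block S T : 'M['F_2]_(#|S|, #|T|) :=
  mxsub (fun i => enum_rank (enum_val i)) (fun j => enum_rank (enum_val j))
        incidence_mx.

Definition A11 := incidence_block anisotropic_points anisotropic_points.
Definition A12 := incidence_block anisotropic_points isotropic_points.
Definition A21 := incidence_block isotropic_points anisotropic_points.
Definition A22 := incidence_block isotropic_points isotropic_points.

End Incidence.

(* Main.v *)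
(** Polarity identifies each point with its hyperplane, so the incidence matrix
    A is symmetric. On the projective line every P^perp is a single point, and A
    is an involutive permutation fixing exactly the isotropic points. In the
    plane two lines meet in one point and a line has q + 1 points, hence
    A^2 = 1 + J over F_2. Two distinct points of the conic are never
    perpendicular, so A22 = 1. The polar line of an anisotropic point is a
    secant or external line: it has 0 or 2 isotropic points, and every pair of
    isotropic points occurs. So A12 is, up to zero rows, the edge-vertex matrix
    of the complete graph on the q + 1 points of the conic, of 2-rank q, and the
    block form of A^2 = 1 + J shows that the kernel of A11 is spanned by the
    all-one vector. *)
Require Import Defs.
From HB Require Import structures.
From mathcomp Require Import all_boot all_order all_algebra all_field.
From mathcomp Require Import ring.
Set Implicit Arguments.
Unset Strict Implicit.
Unset Printing Implicit Defensive.
Import GRing.Theory.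
Local Open Scope ring_scope.

(** * Nondegeneracy of the form and dimensions of perpendicular spaces *)

Section Form.

Variables (F : finFieldType) (n : nat) (alpha : F).
Implicit Types (x y z : 'rV[F]_n.+1).

(** The boolean exponent puts [alpha] on the last coordinate only, so that one sum treats all
    coordinates alike. *)
Definition bform_coef (j : 'I_n.+1) : F := (-1) ^+ j * alpha ^+ (val j == n).

Lemma bformE x y :
  bform alpha x y = \sum_j bform_coef j * x 0 j * y 0 j.
Proof.
rewrite big_ord_recr /bform /bform_coef /= eqxx expr1; congr (_ + _).
by apply: eq_bigr => i _; rewrite (ltn_eqF (ltn_ord i)) expr0 mulr1.
Qed.

Lemma bformC x y : bform alpha x y = bform alpha y x.
Proof. by rewrite !bformE; apply: eq_bigr => j _; rewrite mulrAC. Qed.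

Lemma qformE x : qform alpha x = bform alpha x x.
Proof.
rewrite /qform /bform -!mulrA; congr (_ + _).
by apply: eq_bigr => j _; rewrite -mulrA.
Qed.

Lemma bformZr a x y : bform alpha x (a *: y) = a * bform alpha x y.
Proof.
by rewrite !bformE mulr_sumr; apply: eq_bigr => j _; rewrite mxE mulrCA.
Qed.

Lemma bformDr x y z :
  bform alpha x (y + z) = bform alpha x y + bform alpha x z.
Proof.
by rewrite !bformE -big_split; apply: eq_bigr => j _; rewrite mxE mulrDr.
Qed.

Fact bform_is_linear x : linear (bform alpha x : 'rV[F]_n.+1 -> F^o).
Proof. by move=> a y z; rewrite bformDr bformZr. Qed.

HB.instance Definition _ x :=
  GRing.isLinear.Build F 'rV[F]_n.+1 F^o _ (bform alpha x) (bform_is_linear x).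

Lemma bform0r x : bform alpha x 0 = 0.
Proof. by rewrite -(scale0r 0) bformZr mul0r. Qed.

Lemma bformZl a x y : bform alpha (a *: x) y = a * bform alpha x y.
Proof. by rewrite bformC bformZr bformC. Qed.

Lemma bformDl x y z :
  bform alpha (x + y) z = bform alpha x z + bform alpha y z.
Proof. by rewrite bformC bformDr !(bformC z). Qed.

Definition perpv x : {vspace 'rV[F]_n.+1} :=
  lker (linfun (bform alpha x : 'rV[F]_n.+1 -> F^o)).

Lemma mem_perpv x z : (z \in perpv x) = (bform alpha x z == 0).
Proof. by rewrite memv_ker lfunE. Qed.

(** A functional that is nonzero on [W] has a one-dimensional image, and rank-nullity does the
    rest. *)
Lemma dim_cap_perpv (W : {vspace 'rV[F]_n.+1}) x z :
  z \in W -> bform alpha x z != 0 -> \dim (W :&: perpv x) = (\dim W).-1.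
Proof.
move=> Wz xz_neq0; set f := linfun (bform alpha x : 'rV[F]_n.+1 -> F^o).
rewrite -(limg_ker_dim f W) (_ : \dim (f @: W) = 1%N) ?addn1 //.
apply/eqP; rewrite eqn_leq; apply/andP; split.
  by rewrite (leq_trans (dimvS (subvf _))) // dimvf.
rewrite lt0n dimv_eq0; apply: contraNneq xz_neq0 => fW0.
by have := memv_img f Wz; rewrite fW0 memv0 lfunE.
Qed.

Hypothesis alpha_neq0 : alpha != 0.

Lemma bform_coef_neq0 j : bform_coef j != 0.
Proof. by rewrite mulf_neq0 ?expf_neq0 ?oppr_eq0 ?oner_eq0. Qed.

Lemma bform_nondeg x : (forall z, bform alpha x z = 0) -> x = 0.
Proof.
move=> x0; apply/rowP=> j; have /eqP := x0 (delta_mx 0 j).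
rewrite bformE (bigD1 j) //= big1 => [|i /negPf ne_ij]; last first.
  by rewrite mxE ne_ij andbF mulr0.
by rewrite mxE !eqxx mulr1 addr0 mulf_eq0 (negPf (bform_coef_neq0 j)) mxE => /eqP.
Qed.

Lemma bform_witness x : x != 0 -> exists z, bform alpha x z != 0.
Proof.
move=> x_neq0; apply/existsP; apply: contraNT x_neq0 => /existsPn x0.
by apply/eqP/bform_nondeg => z; have /eqP := negbNE (x0 z).
Qed.

Lemma perpv_sub_line x y :
  (forall z, bform alpha x z = 0 -> bform alpha y z = 0) -> y \in <[x]>%VS.
Proof.
move=> xy0; have [x0|/bform_witness[z0 xz0]] := eqVneq x 0.
  suff -> : y = 0 by apply: mem0v.
  by apply: bform_nondeg => z; apply: xy0; rewrite x0 bformC bform0r.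
apply/vlineP; exists (bform alpha y z0 / bform alpha x z0).
apply/eqP; rewrite -subr_eq0 -scaleNr; apply/eqP/bform_nondeg => z.
(* This is [z] projected along [z0] into the kernel of [bform alpha x]. *)
have := xy0 (z + - (bform alpha x z / bform alpha x z0) *: z0).
rewrite !bformDr !bformZr mulNr divfK // subrr bformDl bformZl => /(_ erefl) <-.
by ring.
Qed.

Lemma dim_perpv x : x != 0 -> \dim (perpv x) = n.
Proof.
move=> /bform_witness[z xz]; rewrite -(capfv (perpv x)).
by rewrite (dim_cap_perpv (memvf z)) // dimvf dim_matrix mul1r.
Qed.

Lemma perpv_witness x y : y \notin <[x]>%VS ->
  exists2 z, bform alpha x z = 0 & bform alpha y z != 0.
Proof.
move=> xy; have /existsP[z /andP[/eqP]] : [exists z,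
  (bform alpha x z == 0) && (bform alpha y z != 0)]; last by exists z.
apply: contraNT xy => /existsPn no_z; apply: perpv_sub_line => z /eqP xz.
by have := no_z z; rewrite xz /= negbK => /eqP.
Qed.

Lemma dim_perpv2 x y : x != 0 -> y \notin <[x]>%VS ->
  \dim (perpv x :&: perpv y) = n.-1.
Proof.
move=> x_neq0 /perpv_witness[z xz yz].
by rewrite (dim_cap_perpv _ yz) ?dim_perpv // mem_perpv xz.
Qed.

End Form.

(** * Points of subspaces and of polar hyperplanes, and their number *)

Section Points.

Variables (F : finFieldType) (n : nat) (alpha : F).
Implicit Types (P R : pg_point F n) (W : {vspace 'rV[F]_n.+1}).

Definition pg_rep P : 'rV[F]_n.+1 := vpick P.

Lemma pg_dim P : \dim P = 1%N.
Proof. exact/eqP/(valP P). Qed.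

Lemma pg_rep_neq0 P : pg_rep P != 0.
Proof. by rewrite vpick0 -dimv_eq0 pg_dim. Qed.

Lemma pg_space_rep P : pg_space P = <[pg_rep P]>%VS.
Proof.
apply/esym/eqP; rewrite eqEdim -memvE memv_pick pg_dim dim_vline.
by rewrite pg_rep_neq0.
Qed.

Lemma pg_rep_inj P R : pg_rep R \in <[pg_rep P]>%VS -> P = R.
Proof.
rewrite memvE -!pg_space_rep => sRP; apply: val_inj; apply/esym/eqP.
by rewrite eqEdim sRP !pg_dim.
Qed.

Lemma pg_point_line (v : 'rV[F]_n.+1) : v != 0 -> {P : pg_point F n | pg_space P = <[v]>%VS}.
Proof.
move=> v0; have dv : \dim <[v]>%VS == 1%N by rewrite dim_vline v0.
by exists (PgPoint dv).
Qed.

Lemma sub_pg_space P W : (P <= W)%VS = (pg_rep P \in W).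
Proof. by rewrite pg_space_rep memvE. Qed.

(** Sort the nonzero vectors of [W] by the line they span: each point accounts for [#|F| - 1] of
    them, and [#|F| - 1] times the geometric sum is the number of nonzero vectors. *)
Lemma card_pg_sub W :
  #|[set R : pg_point F n | (R <= W)%VS]| = (\sum_(i < \dim W) #|F| ^ i)%N.
Proof.
have q_gt1 := finNzRing_gt1 F.
have q1_gt0 : (0 < #|F|.-1)%N by rewrite -ltnS prednK // ltnW.
apply/eqP; rewrite -(eqn_pmul2r q1_gt0) [X in _ == X]mulnC -predn_exp.
rewrite -eqSS prednK ?expn_gt0 ?(ltnW q_gt1) //; apply/eqP.
(* Any nonzero vector will do: its point is the default value of [insubd] in [pt]. *)
have d1 : const_mx 1 != 0 :> 'rV[F]_n.+1.
  by apply: contraTneq isT => /rowP/(_ 0)/eqP; rewrite !mxE oner_eq0.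
have [P0 _] := pg_point_line d1.
pose pt (v : 'rV[F]_n.+1) : pg_point F n := insubd P0 <[v]>%VS.
have ptE v : v != 0 -> pg_space (pt v) = <[v]>%VS.
  by move=> v0; have := @insubdK _ _ (pg_point F n) P0 <[v]>%VS; apply;
     rewrite unfold_in dim_vline v0.
have cardP P : #|[pred v in (P : {vspace _}) | v != 0]| = #|F|.-1.
  have := card_vspace P; rewrite pg_dim expn1 => <-; rewrite [in RHS](cardD1 0) mem0v.
  by apply: eq_card => v; rewrite !inE andbC.
rewrite -card_vspace [in RHS](cardD1 0) mem0v add1n; congr _.+1.
rewrite -[RHS]sum1_card (partition_big pt (fun R => (R <= W)%VS)) /=; last first.
  by move=> v /andP[v0 Wv]; rewrite ptE // -memvE.
rewrite -sum_nat_const big_set /=; apply: eq_bigr => R sRW.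
rewrite -(cardP R) -sum1_card; apply: eq_bigl => v; rewrite !inE.
case: eqVneq => //= [|v0]; rewrite ?andbF // andbT.
apply/idP/andP=> [Rv|[_ /eqP<-]]; last by rewrite ptE ?memv_line.
split; first exact: subvP sRW _ Rv.
apply/eqP/val_inj/eqP; rewrite /= ptE // eqEdim -memvE Rv.
by rewrite pg_dim dim_vline v0.
Qed.

Lemma mem_perp P R :
  (R \in perp alpha P) = (bform alpha (pg_rep P) (pg_rep R) == 0).
Proof.
rewrite inE; apply/idP/idP => [/forallP/(_ (pg_rep P))/forallP/(_ (pg_rep R))|].
  by rewrite !memv_pick.
move/eqP=> PR0; apply/forallP=> x; apply/forallP=> y; apply/implyP.
rewrite !pg_space_rep => /andP[/vlineP[a ->] /vlineP[b ->]].
by rewrite bformZl bformZr PR0 !mulr0.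
Qed.

Lemma mem_isotropic P :
  (P \in isotropic_points n alpha) = (bform alpha (pg_rep P) (pg_rep P) == 0).
Proof.
rewrite inE; apply/forallP/idP => [/(_ (pg_rep P))|/eqP PP0 x].
  by rewrite memv_pick qformE.
apply/implyP; rewrite pg_space_rep => /vlineP[a ->].
by rewrite qformE bformZl bformZr PP0 !mulr0.
Qed.

Lemma perp_sym P R : (R \in perp alpha P) = (P \in perp alpha R).
Proof. by rewrite !mem_perp bformC. Qed.

Lemma perp_self P : (P \in perp alpha P) = (P \in isotropic_points n alpha).
Proof. by rewrite mem_perp mem_isotropic. Qed.

Lemma perpE P :
  perp alpha P = [set R : pg_point F n | (R <= perpv alpha (pg_rep P))%VS].
Proof. by apply/setP=> R; rewrite mem_perp inE sub_pg_space mem_perpv. Qed.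

Lemma perp2E P P' : perp alpha P :&: perp alpha P' =
  [set R : pg_point F n |
     (R <= perpv alpha (pg_rep P) :&: perpv alpha (pg_rep P'))%VS].
Proof. by apply/setP=> R; rewrite !perpE !inE subv_cap. Qed.

Hypothesis alpha_neq0 : alpha != 0.

Lemma card_perp P : #|perp alpha P| = (\sum_(i < n) #|F| ^ i)%N.
Proof. by rewrite perpE card_pg_sub dim_perpv ?pg_rep_neq0. Qed.

Lemma card_perp2 P P' : P != P' ->
  #|perp alpha P :&: perp alpha P'| = (\sum_(i < n.-1) #|F| ^ i)%N.
Proof.
move=> neqPP'; rewrite perp2E card_pg_sub dim_perpv2 ?pg_rep_neq0 //.
by apply: contra neqPP' => /pg_rep_inj ->.
Qed.

End Points.

(** * Products of incidence blocks as intersection numbers modulo 2 *)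

Section Blocks.

Variables (F : finFieldType) (n : nat) (alpha : F).
Implicit Types (S T U : {set pg_point F n}).

Lemma natrF2 k : k%:R = (odd k)%:R :> 'F_2.
Proof.
rewrite -{1}(odd_double_half k) natrD -mul2n natrM.
have -> : 2%:R = 0 :> 'F_2 by apply/val_inj.
by rewrite mul0r addr0.
Qed.

Lemma addrF2 (x : 'F_2) : x + x = 0.
Proof. by rewrite -mulr2n -mulr_natr natrF2 /= mulr0. Qed.

Lemma mx_addrF2 m k (A : 'M['F_2]_(m, k)) : A + A = 0.
Proof. by apply/matrixP=> i j; rewrite !mxE addrF2. Qed.

Lemma incidence_blockE S T i j :
  incidence_block alpha S T i j = (enum_val j \in perp alpha (enum_val i))%:R.
Proof. by rewrite !mxE !enum_rankK. Qed.

Lemma tr_incidence_block S T :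
  (incidence_block alpha S T)^T = incidence_block alpha T S.
Proof. by apply/matrixP=> i j; rewrite mxE !incidence_blockE perp_sym. Qed.

Lemma incidence_block_mulE S U T i j :
  (incidence_block alpha S U *m incidence_block alpha U T) i j =
  #|U :&: (perp alpha (enum_val i) :&: perp alpha (enum_val j))|%:R.
Proof.
rewrite mxE -[in RHS]sum1_card natr_sum.
under [LHS]eq_bigr => k _ do rewrite !incidence_blockE perp_sym -natrM mulnb.
rewrite -(big_enum_val (fun R => ((enum_val i \in perp alpha R)
   && (enum_val j \in perp alpha R))%:R)) /=.
rewrite [RHS](eq_bigl (fun R => (R \in U) && ((enum_val i \in perp alpha R)
   && (enum_val j \in perp alpha R)))); last first.
  by move=> R; rewrite !in_setI -!(perp_sym alpha R).
by rewrite [RHS]big_mkcondr; apply: eq_bigr => R _; case: ifP.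
Qed.

Lemma const_mul_incidence_block m S T (i : 'I_m) j :
  (const_mx 1 *m incidence_block alpha S T) i j =
  #|S :&: perp alpha (enum_val j)|%:R.
Proof.
rewrite mxE -[in RHS]sum1_card natr_sum.
under [LHS]eq_bigr => k _ do rewrite mxE mul1r incidence_blockE perp_sym.
rewrite -(big_enum_val (fun R => (R \in perp alpha (enum_val j))%:R)) /=.
rewrite [RHS](eq_bigl (fun R => (R \in S) && (R \in perp alpha (enum_val j)))).
  by rewrite [RHS]big_mkcondr; apply: eq_bigr => R _; case: ifP.
by move=> R; rewrite in_setI.
Qed.

(** This is a block of the square of the full incidence matrix, the middle index being split into
    [U] and its complement. *)
Lemma incidence_block_mul_setC S T U i j :
  (incidence_block alpha S (~: U) *m incidence_block alpha (~: U) T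
   + incidence_block alpha S U *m incidence_block alpha U T) i j =
  #|perp alpha (enum_val i) :&: perp alpha (enum_val j)|%:R.
Proof.
rewrite mxE !incidence_block_mulE -natrD addnC ![_ :&: (_ :&: _)]setIC.
by rewrite -setDE cardsID.
Qed.

End Blocks.

(** The left kernel is exactly the line of the all-one row, which is nonzero because [m] is
    positive. *)
Lemma rank_ker_const (K : fieldType) m k (M : 'M[K]_(m, k)) :
  (0 < m)%N -> (const_mx 1 : 'rV_m) *m M = 0 ->
  (forall u : 'rV_m, u *m M = 0 -> exists c, u = const_mx c) ->
  \rank M = m.-1.
Proof.
move=> m_gt0 cM0 kerM.
have r1 : \rank (kermx M) = 1%N.
  have <- : \rank (const_mx 1 : 'rV[K]_m) = 1%N.
    rewrite rank_rV; case: eqP => // /rowP/(_ (Ordinal m_gt0))/eqP.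
    by rewrite !mxE oner_eq0.
  apply/eqP; rewrite eqn_leq !mxrankS //; first by apply/sub_kermxP.
  apply/row_subP=> i; have [|c ->] := kerM (row i (kermx M)).
    by apply/sub_kermxP; rewrite row_sub.
  rewrite (_ : const_mx c = c *: const_mx 1) ?scalemx_sub //.
  by apply/rowP=> j; rewrite !mxE mulr1.
have := mxrank_ker M; rewrite r1 => dk.
by rewrite -subn1 dk subKn ?rank_leq_row.
Qed.

(** * The projective line *)

Section ProjectiveLine.

Variables (F : finFieldType) (alpha : F).
Hypothesis alpha_neq0 : alpha != 0.
Implicit Types P R : pg_point F 1.

Lemma card_perp_line P : #|perp alpha P| = 1%N.
Proof. by rewrite card_perp // big_ord1. Qed.

Lemma perp_line_inj P R R' :
  R \in perp alpha P -> R' \in perp alpha P -> R = R'.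
Proof.
have /eqP/cards1P[R0 ->] := card_perp_line P.
by rewrite !inE => /eqP-> /eqP->.
Qed.

Lemma rank_A22_line : \rank (A22 1 alpha) = #|isotropic_points 1 alpha|.
Proof.
suff -> : A22 1 alpha = 1%:M by rewrite mxrank1.
apply/matrixP=> i j; rewrite incidence_blockE mxE; congr (_%:R).
rewrite -(inj_eq enum_val_inj); congr nat_of_bool.
have iP : enum_val i \in perp alpha (enum_val i).
  by rewrite perp_self enum_valP.
by apply/idP/eqP => [/(perp_line_inj iP)|<-].
Qed.

Lemma rank_A11_line : \rank (A11 1 alpha) = #|anisotropic_points 1 alpha|.
Proof.
suff A1 : A11 1 alpha *m A11 1 alpha = 1%:M.
  by apply: mxrank_unit; case/mulmx1_unit: A1.
apply/matrixP=> i j; rewrite incidence_block_mulE mxE.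
have [<-|neq_ij] := eqVneq i j.
  have /eqP/cards1P[R PR] := card_perp_line (enum_val i).
  have Ri : R \in perp alpha (enum_val i) by rewrite PR set11.
  rewrite setIid PR (setIidPr _) ?cards1 // sub1set in_setC -(perp_self alpha).
  (* If the single point [R] of the polar of an anisotropic point were isotropic, its own polar
     would be [R] alone; by symmetry that polar contains the given point, which would then be
     [R]. *)
  apply/negP => RR; have := enum_valP i; rewrite in_setC -(perp_self alpha).
  by rewrite (perp_line_inj (P := R) (R := enum_val i) _ RR) ?RR // -perp_sym.
(* A common point [R] of two polars would have both poles on its own one-point polar. *)
rewrite (_ : _ :&: _ = set0) ?cards0 //; apply/setP=> R; rewrite !in_setI in_set0.
apply: contraNF neq_ij => /and3P[_ iR jR]; rewrite -(inj_eq enum_val_inj).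
by apply/eqP/(perp_line_inj (P := R)); rewrite -perp_sym.
Qed.

End ProjectiveLine.

Lemma odd_card_two_neq0 (F : finFieldType) : odd #|F| -> 2%:R != 0 :> F.
Proof.
move=> oddF; have F0 : #|F|%:R = 0 :> F.
  (* Translation by 1 permutes [F], so adding 1 to each of the [#|F|] terms leaves the sum
     unchanged. *)
  apply: (addrI (\sum_(x : F) x)); rewrite addr0.
  by rewrite [RHS](reindex_inj (addIr 1)) big_split /= sumr_const.
apply/eqP => two0; move: F0; rewrite -(odd_double_half #|F|) oddF.
by rewrite natrD -mul2n natrM two0 mul0r addr0 => /eqP; rewrite oner_eq0.
Qed.

(** * Isotropic points on polar lines in the plane *)

Section ProjectivePlane.

Variables (F : finFieldType) (alpha : F).
Hypothesis alpha_neq0 : alpha != 0.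
Implicit Types P R : pg_point F 2.
Local Notation q := #|F|.
Local Notation I := (isotropic_points 2 alpha).
Local Notation perp := (perp alpha).
Local Notation B := (bform alpha).

Lemma card_perp_plane P : #|perp P| = q.+1.
Proof. by rewrite card_perp // !big_ord_recl big_ord0 addn0 add1n. Qed.

Lemma card_perp2_plane P R : P != R -> #|perp P :&: perp R| = 1%N.
Proof. by move=> neqPR; rewrite card_perp2 // big_ord1. Qed.

Lemma card_plane : #|{: pg_point F 2}| = (1 + q + q ^ 2)%N.
Proof.
have := card_pg_sub (fullv : {vspace 'rV[F]_3}).
rewrite dimvf dim_matrix mul1r !big_ord_recl big_ord0 addn0 addnA => <-.
by rewrite -cardsT; congr #|pred_of_set _|; apply/setP=> R; rewrite !inE subvf.
Qed.

(** Both points would lie on both polars, and polars of distinct points share only one point. *)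
Lemma isotropic_perp_eq P R : P \in I -> R \in I -> R \in perp P -> P = R.
Proof.
move=> PI RI PR; case: (eqVneq P R) => // /card_perp2_plane/eqP/cards1P[Z PRZ].
have PZ : P \in [set Z] by rewrite -PRZ in_setI perp_self PI -perp_sym.
have RZ : R \in [set Z] by rewrite -PRZ in_setI perp_self RI PR.
by move: PZ RZ; rewrite !inE => /eqP-> /eqP->.
Qed.

Lemma A22_plane : A22 2 alpha = 1%:M.
Proof.
apply/matrixP=> i j; rewrite incidence_blockE mxE; congr (_%:R).
rewrite -(inj_eq enum_val_inj); congr nat_of_bool.
apply/idP/eqP => [|<-]; last by rewrite perp_self enum_valP.
by apply: isotropic_perp_eq; rewrite enum_valP.
Qed.

Hypothesis two_neq0 : 2%:R != 0 :> F.

Lemma isotropic_perp_other P R : P \notin I -> R \in I -> R \in perp P ->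
  exists2 R', R' \in I :&: perp P & R' != R.
Proof.
rewrite !mem_isotropic mem_perp => PP RR /eqP PR.
set p := pg_rep P in PP PR *; set r := pg_rep R in RR PR *.
have rp : r \notin <[p]>%VS.
  by apply: contraNN PP => /pg_rep_inj PR'; rewrite /p PR'.
have [s ps rs] := perpv_witness alpha_neq0 rp.
(* Up to the factor [B s s], this is the reflection of [r] in the hyperplane perpendicular to [s].
   Without the division it also covers isotropic [s], where it is a multiple of [s]. *)
pose r' := B s s *: r + (- 2%:R * B r s) *: s.
have rr' : B r r' = - 2%:R * B r s ^+ 2.
  by rewrite bformDr !bformZr (eqP RR); ring.
have rr'_neq0 : B r r' != 0.
  by rewrite rr' mulf_neq0 ?oppr_eq0 ?expf_neq0.
have r'_neq0 : r' != 0 by apply: contraNneq rr'_neq0 => ->; rewrite bform0r.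
have [R' R'E] := pg_point_line r'_neq0.
have /vlineP[c R'c] : pg_rep R' \in <[r']>%VS by rewrite -R'E memv_pick.
exists R'; last first.
  apply: contraNneq rr'_neq0 => R'R; have : r' \in <[r]>%VS.
    by rewrite -pg_space_rep -R'R R'E memv_line.
  by case/vlineP => a ->; rewrite bformZr (eqP RR) mulr0.
rewrite in_setI mem_isotropic mem_perp R'c !bformZl !bformZr.
rewrite [B p r']bformDr !bformZr PR ps !mulr0 addr0 mulr0 eqxx andbT.
rewrite [B r' r']bformDr !bformZr -(bformC alpha r) rr' bformDl !bformZl.
by apply/eqP; ring.
Qed.

(** The polar of [P] is spanned by [r] and [r'], and the quadratic form takes the value
    [2 * a * b * B r r'] at [a *: r + b *: r'], so a zero forces [a] or [b] to vanish. *)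
Lemma isotropic_perp_pair P R R' : P \notin I -> R \in I :&: perp P ->
  R' \in I :&: perp P -> R' != R -> I :&: perp P = [set R; R'].
Proof.
move=> PnI RIP R'IP neqR'R; apply/eqP; rewrite eqEsubset andbC.
rewrite subUset !sub1set RIP R'IP /=; apply/subsetP => Z.
move: RIP R'IP; rewrite !in_setI => /andP[RI RP] /andP[R'I R'P] /andP[ZI ZP].
have RR' : B (pg_rep R) (pg_rep R') != 0.
  rewrite -mem_perp; apply: contraNN neqR'R => /(isotropic_perp_eq RI R'I) ->.
  by [].
have rr' : pg_rep R' \notin <[pg_rep R]>%VS.
  by apply: contraNN neqR'R => /pg_rep_inj ->.
have pE : <[pg_rep P]>%VS =
    (perpv alpha (pg_rep R) :&: perpv alpha (pg_rep R'))%VS.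
  apply/eqP; rewrite eqEdim dim_perpv2 ?pg_rep_neq0 // dim_vline pg_rep_neq0.
  by rewrite andbT -memvE memv_cap !mem_perpv -!mem_perp -!(perp_sym alpha P) RP.
move: PnI RI R'I ZI RP R'P ZP; rewrite !mem_isotropic !mem_perp !inE.
set p := pg_rep P in pE *; set r := pg_rep R in pE RR' rr' *.
set r' := pg_rep R' in pE RR' rr' *; set z := pg_rep Z.
move=> pp /eqP rr /eqP r'r' /eqP zz /eqP pr /eqP pr' /eqP pz.
(* With these coefficients [z - a *: r - b *: r'] is perpendicular to [r] and [r'], hence a multiple
   of [p]; being perpendicular to the anisotropic [p] too, it is zero. *)
pose a := B z r' / B r r'; pose b := B z r / B r r'.
have zE : z = a *: r + b *: r'.
  have : z + (- a) *: r + (- b) *: r' \in <[p]>%VS.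
    rewrite pE memv_cap !mem_perpv !bformDr !bformZr rr r'r' (bformC alpha r z).
    rewrite (bformC alpha r' r) (bformC alpha r' z) /a /b.
    by rewrite !mulNr !divfK // !mulr0 !oppr0 !addr0 !subrr eqxx.
  case/vlineP => c zc; have : B p (c *: p) = 0.
    by rewrite -zc !bformDr !bformZr pr pr' pz !mulr0 !addr0.
  rewrite bformZr => /eqP; rewrite mulf_eq0 (negPf pp) orbF => /eqP c0.
  move: zc; rewrite c0 scale0r !scaleNr -addrA -opprD => /eqP.
  by rewrite subr_eq0 => /eqP.
clearbody a b; have /eqP : 2%:R * (a * b * B r r') = 0.
  rewrite -[RHS]zz zE !bformDr !bformDl !bformZl !bformZr rr r'r'.
  by rewrite (bformC alpha r' r); ring.
rewrite !mulf_eq0 (negPf two_neq0) (negPf RR') orbF /= => /orP[]/eqP c0.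
  apply/orP; right; apply/eqP/esym/pg_rep_inj.
  by apply/vlineP; exists b; rewrite -[LHS]/z zE c0 scale0r add0r.
apply/orP; left; apply/eqP/esym/pg_rep_inj.
by apply/vlineP; exists a; rewrite -[LHS]/z zE c0 scale0r addr0.
Qed.

Lemma even_isotropic_perp P : P \notin I -> ~~ odd #|I :&: perp P|.
Proof.
move=> PnI; have [->|[R RIP]] := set_0Vmem (I :&: perp P); first by rewrite cards0.
have [R' R'IP neqR'R] : exists2 R', R' \in I :&: perp P & R' != R.
  by move: RIP; rewrite in_setI => /andP[]; apply: isotropic_perp_other.
by rewrite (isotropic_perp_pair PnI RIP R'IP neqR'R) cards2 eq_sym neqR'R.
Qed.

(** The witness is the pole of the secant, the meet of the polars of [R] and [R']; were it
    isotropic, it would equal both. *)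
Lemma secant_exists R R' : R \in I -> R' \in I -> R' != R ->
  exists2 P, P \notin I & I :&: perp P = [set R; R'].
Proof.
move=> RI R'I neqR'R; have /eqP : #|perp R :&: perp R'| = 1%N.
  by rewrite card_perp2_plane // eq_sym.
case/cards1P => P PE; have : P \in perp R :&: perp R' by rewrite PE set11.
rewrite in_setI => /andP[RP R'P]; have PnI : P \notin I.
  apply: contraNN neqR'R => PI; rewrite (isotropic_perp_eq R'I PI R'P).
  by rewrite (isotropic_perp_eq RI PI RP).
by exists P => //; apply: isotropic_perp_pair; rewrite // in_setI ?RI ?R'I -perp_sym.
Qed.

(** * Rational parametrization of the conic *)

Lemma bform_planeE (x y : 'rV[F]_3) : B x y =
  x 0 ord0 * y 0 ord0 - x 0 (inord 1) * y 0 (inord 1)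
  + alpha * x 0 ord_max * y 0 ord_max.
Proof.
rewrite /bform !big_ord_recl big_ord0.
have -> : widen_ord (leqnSn 2) ord0 = ord0 by apply: val_inj.
have -> : widen_ord (leqnSn 2) (lift ord0 ord0) = inord 1.
  by apply: val_inj; rewrite /= inordK.
by rewrite /=; ring.
Qed.

Definition vec3 (a b c : F) : 'rV[F]_3 := \row_(j < 3) nth 0 [:: a; b; c] j.

Lemma vec3E a b c : (vec3 a b c 0 ord0 = a) * (vec3 a b c 0 (inord 1) = b)
  * (vec3 a b c 0 ord_max = c).
Proof. by split; first split; rewrite !mxE ?inordK. Qed.

Lemma vec3_eta (x : 'rV[F]_3) : x = vec3 (x 0 ord0) (x 0 (inord 1)) (x 0 ord_max).
Proof.
apply/rowP=> j; rewrite mxE; case: j => -[|[|[|]]] // lt_j3 /=;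
  by congr (x _ _); apply: val_inj; rewrite /= ?inordK.
Qed.

Lemma vec3Z d a b c : d *: vec3 a b c = vec3 (d * a) (d * b) (d * c).
Proof. by apply/rowP=> -[[|[|[|]]] // lt_j3]; rewrite !mxE. Qed.

Lemma vec3_inj a b c a' b' c' :
  vec3 a b c = vec3 a' b' c' -> [/\ a = a', b = b' & c = c'].
Proof.
move=> E; have := (vec3E a b c, vec3E a' b' c').
by rewrite E => -[[[-> ->] ->] [[-> ->] ->]].
Qed.

(* In the coordinates x0 - x1, x0 + x1, x2 the conic (x0 - x1)(x0 + x1) =
   - alpha x2^2 is parametrized by (2, - 2 alpha t^2, 2t), plus (0, 2, 0). *)
Definition conic_vec (o : option F) : 'rV[F]_3 :=
  if o is Some t then vec3 (1 - alpha * t ^+ 2) (- 1 - alpha * t ^+ 2) (2%:R * t)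
  else vec3 1 1 0.

Lemma conic_vec_neq0 o : conic_vec o != 0.
Proof.
apply: contraNneq two_neq0 => o0.
(* The pairing with [vec3 1 1 0] is 2 on every [Some t]; the vector of [None] is settled by its
   first coordinate. *)
have : B (conic_vec o) (vec3 1 1 0) = 0 by rewrite o0 bformC bform0r.
have : conic_vec o 0 ord0 = 0 by rewrite o0 mxE.
case: o {o0} => [t|] /=; rewrite bform_planeE !vec3E => e0.
  by move=> B0; apply/eqP; rewrite -[RHS]B0; ring.
by have := oner_neq0 F; rewrite e0 eqxx.
Qed.

Lemma conic_vec_isotropic o : B (conic_vec o) (conic_vec o) = 0.
Proof.
by case: o => [t|] /=; rewrite bform_planeE !vec3E; ring.
Qed.

(** The first coordinate minus the second is 2 on [Some t] and 0 on [None]. This separates the two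
    cases and forces the scalar [c] to be 1 between two finite parameters. *)
Lemma conic_vec_inj o o' : conic_vec o \in <[conic_vec o']>%VS -> o = o'.
Proof.
have half a b : 2%:R * a = 2%:R * b :> F -> a = b by apply: mulfI.
case/vlineP=> c; case: o o' => [t|] [t'|] //=; rewrite vec3Z.
- case/vec3_inj => e0 e1 e2; have c1 : 1 = c.
    apply: half; have -> : 2%:R * 1 = 1 - alpha * t ^+ 2 - (- 1 - alpha * t ^+ 2).
      by ring.
    by rewrite e0 e1; ring.
  by congr Some; apply: half; rewrite e2 -c1; ring.
- case/vec3_inj => e0 e1 _; case/eqP: two_neq0.
  have -> : 2%:R = 1 - alpha * t ^+ 2 - (- 1 - alpha * t ^+ 2) by ring.
  by rewrite e0 e1 subrr.
case/vec3_inj => e0 e1 _; have /eqP := oner_neq0 F; case.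
have c0 : c = 0; last by rewrite e0 c0 mul0r.
apply: half; have -> : 2%:R * c = c * (1 - alpha * t' ^+ 2)
    - c * (- 1 - alpha * t' ^+ 2) by ring.
by rewrite -e0 -e1 subrr mulr0.
Qed.

Lemma conic_vec_surj (x : 'rV[F]_3) : B x x = 0 -> exists o, x \in <[conic_vec o]>%VS.
Proof.
rewrite [x]vec3_eta; set a := x 0 _; set b := x 0 _; set c := x 0 _.
rewrite bform_planeE !vec3E => abc.
have [ab|neq_ab] := eqVneq a b.
  exists None; have /eqP : alpha * c * c = 0 by rewrite -abc ab; ring.
  rewrite !mulf_eq0 (negPf alpha_neq0) orbb /= => /eqP->.
  by apply/vlineP; exists a; rewrite vec3Z -ab mulr1 mulr0.
have d_neq0 : a - b != 0 by rewrite subr_eq0.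
have abE : alpha * c ^+ 2 = - (a - b) * (a + b).
  by apply/eqP; rewrite -subr_eq0 -abc; apply/eqP; ring.
(* Scaling the difference [a - b] of the first two coordinates to 2 gives the factor, and the last
   coordinate then gives the parameter. *)
exists (Some (c / (a - b))); apply/vlineP; exists ((a - b) / 2%:R).
have tE : alpha * (c / (a - b)) ^+ 2 = - (a + b) / (a - b).
  by rewrite expr_div_n mulrA abE; field.
by rewrite vec3Z tE; congr vec3; field; rewrite ?two_neq0 ?d_neq0.
Qed.

Lemma card_isotropic_plane : #|I| = q.+1.
Proof.
pose f o : pg_point F 2 := sval (pg_point_line (conic_vec_neq0 o)).
have fE o : pg_space (f o) = <[conic_vec o]>%VS by rewrite /f; case: pg_point_line.
have f_inj : injective f.
  move=> o o' ff'; apply: conic_vec_inj; rewrite -fE -ff' fE.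
  exact: memv_line.
rewrite -card_option -cardsT -(card_imset _ f_inj); apply: eq_card => P.
rewrite mem_isotropic; apply/eqP/imsetP => [/conic_vec_surj[o Po]|[o _ ->]].
  exists o => //; apply/val_inj/eqP; rewrite /= eqEdim fE.
  by rewrite sub_pg_space Po dim_vline conic_vec_neq0 pg_dim.
have /vlineP[c ->] : pg_rep (f o) \in <[conic_vec o]>%VS by rewrite -fE memv_pick.
by rewrite bformZl bformZr conic_vec_isotropic !mulr0.
Qed.

Lemma card_anisotropic_plane : #|anisotropic_points 2 alpha| = (q ^ 2)%N.
Proof.
by apply/eqP; rewrite -(eqn_add2l #|I|) cardsC card_isotropic_plane card_plane.
Qed.

(** * The 2-ranks of the blocks in the plane *)

Local Notation A := (anisotropic_points 2 alpha).

(** Column sums of [A21] count the isotropic points on polars of anisotropic points, an even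
    number. *)
Lemma const_mul_A21 m : (const_mx 1 : 'M_(m, _)) *m A21 2 alpha = 0.
Proof.
apply/matrixP=> i j; rewrite const_mul_incidence_block mxE natrF2.
have := enum_valP j; rewrite in_setC => /even_isotropic_perp.
by case: odd.
Qed.

Lemma rank_A21_plane : \rank (A21 2 alpha) = q.
Proof.
have I_gt0 : (0 < #|I|)%N by rewrite card_isotropic_plane.
have -> : q = #|I|.-1 by rewrite card_isotropic_plane.
apply: rank_ker_const => //; first exact: const_mul_A21.
move=> u uA21; pose i0 := Ordinal I_gt0; exists (u 0 i0).
apply/rowP=> i; rewrite mxE; have [->//|neq_i] := eqVneq i i0.
have neqR : enum_val i != enum_val i0 by rewrite (inj_eq enum_val_inj).
(* The column of the pole [P] has ones exactly in rows [i0] and [i], so [u 0 i + u 0 i0 = 0], which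
   is equality in characteristic 2. *)
have [P PnI PE] := secant_exists (enum_valP i0) (enum_valP i) neqR.
have PA : P \in A by rewrite in_setC.
have /rowP/(_ (enum_rank_in PA P)) := uA21.
rewrite !mxE (bigD1 i) //= (bigD1 i0) 1?eq_sym //=.
have memP k : (P \in perp (enum_val k)) = (k == i0) || (k == i).
  have : (enum_val k \in I :&: perp P) = (k == i0) || (k == i).
    by rewrite PE in_set2 !(inj_eq enum_val_inj).
  by rewrite in_setI enum_valP /= perp_sym.
rewrite big1 => [|k /andP[ki ki0]]; rewrite !incidence_blockE enum_rankK_in // memP.
  rewrite memP !eqxx orbT !mulr1 addr0 => /eqP.
  by rewrite -{1}(addrF2 (u 0 i0)) => /eqP/addIr.
by rewrite (negPf ki) (negPf ki0) mulr0.
Qed.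

Lemma rank_A12_plane : \rank (A12 2 alpha) = q.
Proof. by rewrite -mxrank_tr tr_incidence_block rank_A21_plane. Qed.

(* Modulo 2 the incidence matrix squares to 1 + J, as q + 1 is even. With
   A22 = 1, its blocks give A11 A12 + A12 = J and A11^2 + A12 A21 = 1 + J, and
   J A21 = 0: so u A11 = 0 forces u A12 = u J, u A12 A21 = 0 and u = u J. *)
Lemma rank_A11_plane : odd q -> \rank (A11 2 alpha) = (q ^ 2 - 1)%N.
Proof.
move=> q_odd; rewrite subn1 -card_anisotropic_plane.
apply: rank_ker_const => [||u uA11].
- by rewrite card_anisotropic_plane expn_gt0 (ltnW (finNzRing_gt1 F)).
- apply/rowP=> j; rewrite const_mul_incidence_block mxE natrF2.
  (* A polar has [q + 1] points, an even number, of which evenly many are isotropic; so evenly many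
     are anisotropic. *)
  have : odd (#|perp (enum_val j) :&: I| + #|perp (enum_val j) :\: I|) = false.
    by rewrite cardsID card_perp_plane /= q_odd.
  have := enum_valP j; rewrite in_setC => /even_isotropic_perp /negPf jI.
  by rewrite oddD setIC jI setDE setIC /= => ->.
have A11_12 : A11 2 alpha *m A12 2 alpha + A12 2 alpha = const_mx 1.
  (* Writing [A12] as [A12 *m A22] exhibits the sum as an off-diagonal block of the squared
     incidence matrix. *)
  rewrite -[A12 2 alpha in X in _ + X]mulmx1 -A22_plane.
  apply/matrixP=> i j; rewrite incidence_block_mul_setC mxE card_perp2_plane //.
  apply: contraTneq (enum_valP j) => <-.
  by have := enum_valP i; rewrite in_setC.
have A11_11 :
    A11 2 alpha *m A11 2 alpha + A12 2 alpha *m A21 2 alpha = 1%:M + const_mx 1.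
  apply/matrixP=> i j; rewrite incidence_block_mul_setC !mxE.
  have [<-|neq_ij] := eqVneq i j.
    (* On the diagonal both sides vanish: [q + 1] is even and [1 + 1 = 0]. *)
    by rewrite setIid card_perp_plane natrF2 /= q_odd addrF2.
  by rewrite card_perp2_plane ?add0r // (inj_eq enum_val_inj).
have uA12 : u *m A12 2 alpha = u *m const_mx 1.
  by rewrite -A11_12 mulmxDr mulmxA uA11 mul0mx add0r.
have : u *m (1%:M + const_mx 1) = 0.
  rewrite -A11_11 mulmxDr !mulmxA uA11 uA12 mul0mx add0r -mulmxA.
  by rewrite const_mul_A21 mulmx0.
rewrite mulmxDr mulmx1 => /eqP.
rewrite -{1}(mx_addrF2 (u *m const_mx 1)) => /eqP/addIr uE.
exists (\sum_k u 0 k); apply/rowP=> i; rewrite {1}uE !mxE.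
by apply: eq_bigr => k _; rewrite mxE mulr1.
Qed.

End ProjectivePlane.

Theorem theorem1p8 (q : nat) (F : finFieldType) (alpha : F)
    (q_odd : odd q) (card_F : #|F| = q) (alpha_neq0 : alpha != 0) :
  (\rank (A11 1 alpha) = #|anisotropic_points 1 alpha| /\
   \rank (A22 1 alpha) = #|isotropic_points 1 alpha|) /\
  (\rank (A11 2 alpha) = (q ^ 2 - 1)%N /\
   \rank (A12 2 alpha) = q /\
   \rank (A21 2 alpha) = q /\
   \rank (A22 2 alpha) = #|isotropic_points 2 alpha|).
Proof.
subst q; have two_neq0 := odd_card_two_neq0 q_odd.
split; first by split; [exact: rank_A11_line | exact: rank_A22_line].
split; first exact: rank_A11_plane.
split; first exact: rank_A12_plane.
split; first exact: rank_A21_plane.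
by rewrite A22_plane // mxrank1.
Qed.
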